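(* Let $\mathcal{A}=\mathbb{C}[x,y]$, let $n$ be a positive integer, let $\alpha_1,\dots,\alpha_n\in\mathbb{C}$ with $\alpha_1\alpha_n\neq 0$, put $h_t=\sum_{i=1}^n\alpha_i t^{i-1}$ and assume $\gcd(h_t,h_t')=1$ in $\mathbb{C}[t]$. Let $h_{xy}=h_t(xy)$, $h=xy\,h_{xy}$, $\mathcal I=h\mathcal A$, and let $$\delta^1=h_{xy}(x\partial_x+y\partial_y),\quad \delta^2=y\partial_y-x\partial_x,\quad \omega_1=\frac{y}{2h}dx+\frac{x}{2h}dy,\quad \omega_2=\frac{dy}{2y}-\frac{dx}{2x}.$$ For all $a,b\in\mathcal A$ and $\omega=a\omega_1+b\omega_2\in\Omega^1_{\mathcal A}(\log\mathcal I)$, $$\pi^\sharp_{\log}(\omega)=\tfrac12\big(a\,\delta^2-b\,\delta^1\big)\in Der_{\mathcal A}(\log\mathcal I).$$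
   Context: $Der_{\mathcal A}(\log\mathcal I)=\{\delta\in Der_{\mathcal A}:\delta(h)\in h\mathcal A\}=\mathcal A\delta^1\oplus\mathcal A\delta^2$ and $\Omega^1_{\mathcal A}(\log\mathcal I)=\mathcal A\omega_1\oplus\mathcal A\omega_2$ is its dual. The Hamiltonian map of the Poisson bracket with $\{x,y\}_h=h$ is the $\mathcal A$-linear map $H:\Omega_{\mathcal A}\to Der_{\mathcal A}$, $H(df)=\{f,\cdot\}_h$, so $H(dx)=h\partial_y$, $H(dy)=-h\partial_x$. Let $\mathcal A_h=\mathcal A[h^{-1}]$ and let $H_h:\Omega_{\mathcal A_h}\to Der_{\mathcal A_h}$ be the $\mathcal A_h$-linear extension, $H_h(\omega/h^k)=H(\omega)/h^k$. The logarithmic Hamiltonian map $\pi^\sharp_{\log}=\widetilde H:\Omega^1_{\mathcal A}(\log\mathcal I)\to Der_{\mathcal A}(\log\mathcal I)$ is the restriction of $H_h$ to $\Omega^1_{\mathcal A}(\log\mathcal I)\subset\Omega_{\mathcal A_h}$. *)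

(* Defs.v *)
From HB Require Import structures.
From mathcomp Require Import all_boot all_order all_algebra.
From mathcomp Require Import mpoly.
From mathcomp Require Import complex.
From mathcomp Require Import boolp reals.
From mathcomp Require Import ring.

Set Implicit Arguments.
Unset Strict Implicit.
Unset Printing Implicit Defensive.

Import GRing.Theory.
Local Open Scope ring_scope.
Local Open Scope quotient_scope.

Definition leibniz (B : nzRingType) (d : B -> B) :=
  forall f g, d (f * g) = f * d g + g * d f.

(* K-linear derivations of a commutative K-algebra B, as a B-module. *)
Section Derivations.
Variables (K : comNzRingType) (B : comAlgType K).

Record der := Der { der_fun :> {linear B -> B}; der_leibniz : leibniz der_fun }.

HB.instance Definition _ := gen_eqMixin der.
HB.instance Definition _ := gen_choiceMixin der.

Lemma der_ext (d e : der) : d =1 e -> d = e.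
Proof.
case: d e => [d dL] [e eL] /= de.
have {}de : d = e.
  case: d e {dL eL} de => [d cd] [e ce] /= /funext de.
  rewrite de in cd *; congr GRing.Linear.Pack.
  case: cd ce => [[c1] [c2]] [[c3] [c4]].
  by rewrite (Prop_irrelevance c1 c3) (Prop_irrelevance c2 c4).
by rewrite -de in eL *; congr Der; exact: Prop_irrelevance.
Qed.

Lemma der1 (d : der) : d 1 = 0.
Proof.
by apply: (addrI (d 1)); rewrite addr0 -[in RHS](mulr1 1) der_leibniz !mul1r.
Qed.

Lemma der0_subproof : leibniz (\0 : {linear B -> B}).
Proof. by move=> f g /=; rewrite !mulr0 addr0. Qed.
Definition der0 := Der der0_subproof.

Lemma derD_subproof (d e : der) : leibniz (d \+ e).
Proof. by move=> f g /=; rewrite !der_leibniz; ring. Qed.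
Definition derD d e := Der (derD_subproof d e).

Lemma derN_subproof (d : der) : leibniz (\- d).
Proof. by move=> f g /=; rewrite !der_leibniz; ring. Qed.
Definition derN d := Der (derN_subproof d).

Lemma derZ_subproof (a : B) (d : der) : leibniz (a \*o d).
Proof. by move=> f g /=; rewrite !der_leibniz; ring. Qed.
Definition derZ a d := Der (derZ_subproof a d).

Lemma der_addA : associative derD.
Proof. by move=> d e f; apply: der_ext => u /=; rewrite addrA. Qed.
Lemma der_addC : commutative derD.
Proof. by move=> d e; apply: der_ext => u /=; rewrite addrC. Qed.
Lemma der_add0 : left_id der0 derD.
Proof. by move=> d; apply: der_ext => u /=; rewrite add0r. Qed.
Lemma der_addN : left_inverse der0 derN derD.
Proof. by move=> d; apply: der_ext => u /=; rewrite addNr. Qed.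

HB.instance Definition _ :=
  GRing.isZmodule.Build der der_addA der_addC der_add0 der_addN.

Lemma der_scaleA a b d : derZ a (derZ b d) = derZ (a * b) d.
Proof. by apply: der_ext => u /=; rewrite mulrA. Qed.
Lemma der_scale1 : left_id 1 derZ.
Proof. by move=> d; apply: der_ext => u /=; rewrite mul1r. Qed.
Lemma der_scaleDr : right_distributive derZ +%R.
Proof. by move=> a d e; apply: der_ext => u /=; rewrite mulrDr. Qed.
Lemma der_scaleDl d : {morph derZ^~ d : a b / a + b}.
Proof. by move=> a b; apply: der_ext => u /=; rewrite mulrDl. Qed.

HB.instance Definition _ := GRing.Zmodule_isLmodule.Build B der
  der_scaleA der_scale1 der_scaleDr der_scaleDl.

Lemma derDE (d e : der) f : (d + e) f = d f + e f. Proof. by []. Qed.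
Lemma derNE (d : der) f : (- d) f = - d f. Proof. by []. Qed.
Lemma derZE a (d : der) f : (a *: d) f = a * d f. Proof. by []. Qed.

End Derivations.

(* Extension of a derivation of an integral domain to its field of fractions,
   by the quotient rule. *)
Section FractionDerivation.
Variables (A : idomainType) (d : A -> A).
Local Notation "f %:F" := (FracField.tofrac f).

Definition frac_der (u : {fraction A}) : {fraction A} :=
  let n := \n_(repr u) in let m := \d_(repr u) in
  (d n * m - n * d m)%:F / m%:F ^+ 2.

Hypothesis dD : {morph d : f g / f + g}.
Hypothesis dL : leibniz d.

Lemma frac_repr (u : {fraction A}) :
  u = (\n_(repr u))%:F / (\d_(repr u))%:F.
Proof.
rewrite -[LHS]reprK; case: (repr u) => -[n m] /= m0.
have mF : m%:F != 0 by rewrite tofrac_eq0.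
apply: (mulIf mF); rewrite divfK //.
unlock FracField.tofrac; rewrite -[LHS]FracField.pi_mul.
by rewrite /FracField.mulf /= !numden_Ratio ?oner_eq0 // mulr1;
  apply/eqmodP; rewrite /= FracField.equivfE !numden_Ratio ?oner_eq0 // mulr1 mulrC.
Qed.

Lemma quotient_rule_subproof  (n m f g dn dm df dg : A) :
    g != 0 -> n * g = f * m -> n * dg + g * dn = f * dm + m * df ->
  (dn * m - n * dm) * g ^+ 2 = (df * g - f * dg) * m ^+ 2.
Proof.
move=> g0 e1 e2.
have -> : (dn * m - n * dm) * g ^+ 2 =
  m * g * (n * dg + g * dn) - m * (n * g) * dg - (n * g) * g * dm by ring.
by rewrite e2 e1; ring.
Qed.

Lemma d1 : d 1 = 0.
Proof. by apply: (addrI (d 1)); rewrite addr0 -[in RHS](mulr1 1) dL !mul1r. Qed.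

Lemma frac_derE f g : g != 0 ->
  frac_der (f%:F / g%:F) = (d f * g - f * d g)%:F / g%:F ^+ 2.
Proof.
move=> g0; rewrite /frac_der; set u := (f%:F / g%:F).
have := frac_repr u; have := denom_ratioP (repr u).
move: (\n_(repr u)) (\d_(repr u)) => n m m0.
have gF : g%:F != 0 by rewrite tofrac_eq0.
have mF : m%:F != 0 by rewrite tofrac_eq0.
rewrite /u => /eqP; rewrite eqr_div // -!tofracM tofrac_eq => /eqP e.
apply/eqP; rewrite eqr_div ?expf_neq0 // -!tofracXn -!tofracM tofrac_eq.
apply/eqP; apply: quotient_rule_subproof => //.
by rewrite -!dL e.
Qed.

Lemma frac_der_tofrac f : frac_der f%:F = (d f)%:F.
Proof.
rewrite -[f%:F]divr1 -tofrac1 frac_derE ?oner_neq0 //.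
by rewrite d1 mulr0 mulr1 subr0 tofrac1 expr1n divr1.
Qed.

Lemma fracP (u : {fraction A}) :
  exists f g, g != 0 /\ u = f%:F / g%:F.
Proof.
by exists (\n_(repr u)), (\d_(repr u)); split; [exact: denom_ratioP|exact: frac_repr].
Qed.

Lemma frac_derD u v : frac_der (u + v) = frac_der u + frac_der v.
Proof.
have [f [g [g0 ->]]] := fracP u; have [p [q [q0 ->]]] := fracP v.
have gF : g%:F != 0 by rewrite tofrac_eq0.
have qF : q%:F != 0 by rewrite tofrac_eq0.
rewrite addf_div // -!tofracM -tofracD !frac_derE ?mulf_neq0 //.
rewrite addf_div ?expf_neq0 // -!tofracXn -!tofracM -tofracD.
congr (_%:F / _%:F); last by rewrite exprMn.
rewrite !dD !dL; move: (d f) (d g) (d p) (d q) => df dg dp dq.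
ring.
Qed.

Lemma frac_derM : leibniz frac_der.
Proof.
move=> u v.
have [f [g [g0 ->]]] := fracP u; have [p [q [q0 ->]]] := fracP v.
have gF : g%:F != 0 by rewrite tofrac_eq0.
have qF : q%:F != 0 by rewrite tofrac_eq0.
rewrite mulf_div -!tofracM !frac_derE ?mulf_neq0 // !mulf_div.
rewrite addf_div ?mulf_neq0 ?expf_neq0 //.
rewrite -!tofracXn -!tofracM -tofracD.
apply/eqP; rewrite eqr_div ?tofrac_eq0 ?(mulf_neq0, expf_neq0) //.
rewrite -!tofracM tofrac_eq; apply/eqP.
rewrite !dL; move: (d f) (d g) (d p) (d q) => df dg dp dq.
ring.
Qed.

End FractionDerivation.

Section LogarithmicHamiltonian.
Variable K : fieldType.

Local Notation A := {mpoly K[2]}.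
Local Notation "f %:F" := (FracField.tofrac f).

Definition polX : A := 'X_0.
Definition polY : A := 'X_1.

Lemma partial_subproof (i : 'I_2) : leibniz (@mderiv 2 K i).
Proof. by move=> f g; rewrite mderivM addrC [_ * g]mulrC. Qed.
Definition partial i : der A := Der (partial_subproof i).
Definition partialX := partial 0.
Definition partialY := partial 1.

(* The localization A[h^-1], as the K-algebra of the fractions f / h^k in the
   field of fractions of A; it is meant for h != 0. *)
Section Localization.
Variable h : A.

Definition is_loc (u : {fraction A}) : bool :=
  `[< exists f k, u = f%:F / h%:F ^+ k >].

Lemma is_locP u : reflect (exists f k, u = f%:F / h%:F ^+ k) (is_loc u).
Proof. exact: asboolP. Qed.

Lemma is_loc_tofrac f : is_loc f%:F.
Proof. by apply/is_locP; exists f, 0; rewrite expr0 divr1. Qed.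

Lemma is_loc_subring : subring_closed is_loc.
Proof.
split=> [|u v /is_locP[f [k ->]] /is_locP[g [l ->]]
         |u v /is_locP[f [k ->]] /is_locP[g [l ->]]].
- by rewrite -tofrac1; exact: is_loc_tofrac.
- have [h0|h0] := eqVneq h 0; last first.
    apply/is_locP; exists (f * h ^+ l - g * h ^+ k), (k + l)%N.
    have hF : h%:F != 0 by rewrite tofrac_eq0.
    rewrite exprD tofracB !tofracM !tofracXn -mulNr addf_div ?expf_neq0 //.
    by rewrite mulNr.
  have tofracS a m : a%:F / h%:F ^+ m.+1 = 0%:F.
    by rewrite h0 exprS tofrac0 mul0r invr0 mulr0.
  rewrite -[_ \in _]/(is_loc _).
  case: k l => [|k] [|l]; rewrite ?tofracS ?expr0 ?divr1 -tofracB;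
    exact: is_loc_tofrac.
- apply/is_locP; exists (f * g), (k + l)%N.
  by rewrite exprD tofracM invfM mulrACA.
Qed.

HB.instance Definition _ :=
  GRing.isSubringClosed.Build {fraction A} is_loc is_loc_subring.

Record loc := Loc { loc_val :> {fraction A}; _ : is_loc loc_val }.

HB.instance Definition _ := [isSub for loc_val].
HB.instance Definition _ := [Choice of loc by <:].
HB.instance Definition _ := [SubChoice_isSubComNzRing of loc by <:].

Definition toloc (f : A) : loc := Loc (is_loc_tofrac f).

Lemma toloc_zmod : zmod_morphism toloc.
Proof. by move=> f g; apply: val_inj; rewrite /= tofracB. Qed.
Lemma toloc_monoid : monoid_morphism toloc.
Proof. by split=> [|f g]; apply: val_inj; rewrite /= ?tofrac1 ?tofracM. Qed.
HB.instance Definition _ := GRing.isZmodMorphism.Build A loc toloc toloc_zmod.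
HB.instance Definition _ :=
  GRing.isMonoidMorphism.Build A loc toloc toloc_monoid.

Lemma toloc_inj : injective toloc.
Proof. by move=> f g /(congr1 val)/= /eqP; rewrite tofrac_eq => /eqP. Qed.

Definition loc_scale (c : K) (u : loc) : loc := toloc c%:MP * u.

Lemma loc_scaleA a b u : loc_scale a (loc_scale b u) = loc_scale (a * b) u.
Proof. by rewrite /loc_scale mpolyCM rmorphM mulrA. Qed.
Lemma loc_scale1 : left_id 1 loc_scale.
Proof. by move=> u; rewrite /loc_scale rmorph1 mul1r. Qed.
Lemma loc_scaleDr : right_distributive loc_scale +%R.
Proof. by move=> a u v; rewrite /loc_scale mulrDr. Qed.
Lemma loc_scaleDl u : {morph loc_scale^~ u : a b / a + b}.
Proof. by move=> a b; rewrite /loc_scale mpolyCD rmorphD mulrDl. Qed.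
HB.instance Definition _ := GRing.Zmodule_isLmodule.Build K loc
  loc_scaleA loc_scale1 loc_scaleDr loc_scaleDl.

Lemma loc_scaleAl (a : K) (u v : loc) : a *: (u * v) = (a *: u) * v.
Proof. exact: mulrA. Qed.
HB.instance Definition _ := GRing.Lmodule_isLalgebra.Build K loc loc_scaleAl.
HB.instance Definition _ := GRing.Lalgebra_isComAlgebra.Build K loc.

Definition loc_unit : {pred loc} :=
  fun u => (val u != 0) && is_loc (val u)^-1.
Definition loc_inv (u : loc) : loc :=
  if loc_unit u then insubd u (val u)^-1 else u.

Lemma loc_invE u : loc_unit u -> val (loc_inv u) = (val u)^-1.
Proof.
by move=> uu; rewrite /loc_inv uu val_insubd; case/andP: uu => _ ->.
Qed.
Lemma loc_mulV : {in loc_unit, left_inverse 1 loc_inv *%R}.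
Proof.
move=> u uu; apply: val_inj; rewrite /= loc_invE // mulVf //.
by case/andP: uu.
Qed.
Lemma loc_unitPl (u v : loc) : v * u = 1 -> loc_unit u.
Proof.
move=> /(congr1 val) /= vu.
have u0 : val u != 0 by apply: contra_eq_neq vu => ->; rewrite mulr0 eq_sym oner_neq0.
by rewrite /loc_unit u0 /= -[_^-1]mul1r -vu mulfK // (valP v).
Qed.
Lemma loc_inv_out : {in [predC loc_unit], loc_inv =1 id}.
Proof. by move=> u /negbTE uu; rewrite /loc_inv [loc_unit u]uu. Qed.
HB.instance Definition _ := GRing.ComNzRing_hasMulInverse.Build loc
  loc_mulV loc_unitPl loc_inv_out.

End Localization.
Section Extension.
Variables (h : A) (d : der A).

Let dD : {morph d : f g / f + g} := raddfD d.
Let dL : leibniz d := @der_leibniz _ _ d.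

Lemma frac_der_loc u : is_loc h u -> is_loc h (frac_der d u).
Proof.
move=> /is_locP[f [k ->]]; have [hk0|hk0] := eqVneq (h ^+ k) 0.
  rewrite -tofracXn hk0 tofrac0 invr0 mulr0 -tofrac0 (frac_der_tofrac dL).
  exact: is_loc_tofrac.
apply/is_locP; rewrite -tofracXn (frac_derE dL) //.
by exists (d f * h ^+ k - f * d (h ^+ k)), (k * 2)%N; rewrite tofracXn exprM.
Qed.

Definition loc_der (u : loc h) : loc h := Loc (frac_der_loc (valP u)).

Lemma loc_der_zmod : zmod_morphism loc_der.
Proof.
move=> u v; apply: val_inj => /=; rewrite (frac_derD dD dL); congr (_ + _).
apply: (addIr (frac_der d (val v))); rewrite -(frac_derD dD dL) addNr.
by rewrite -tofrac0 (frac_der_tofrac dL) raddf0 tofrac0 addNr.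
Qed.
Lemma loc_der_scale : scalable loc_der.
Proof.
move=> c u; apply: val_inj => /=; rewrite (frac_derM dL) (frac_der_tofrac dL).
rewrite -[c%:MP]mulr1 mul_mpolyC linearZ /= der1 scaler0 tofrac0 mulr0 addr0.
by [].
Qed.
HB.instance Definition _ :=
  GRing.isZmodMorphism.Build (loc h) (loc h) loc_der loc_der_zmod.
HB.instance Definition _ :=
  GRing.isScalable.Build K (loc h) (loc h) *:%R loc_der loc_der_scale.

Lemma loc_der_leibniz : leibniz loc_der.
Proof. by move=> u v; apply: val_inj; rewrite /= (frac_derM dL). Qed.

Definition ext_der : der (loc h) := Der loc_der_leibniz.

Lemma ext_derE f : ext_der (toloc h f) = toloc h (d f).
Proof. by apply: val_inj; rewrite /= (frac_der_tofrac dL). Qed.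

End Extension.

Section ExtensionLinear.
Variable h : A.

Lemma ext_derD d e : ext_der h (d + e) = ext_der h d + ext_der h e.
Proof.
apply: der_ext => u; apply: val_inj; rewrite /= /frac_der /= -mulrDl -tofracD.
by congr (_%:F / _); rewrite mulrDl mulrDr opprD addrACA.
Qed.

Lemma ext_derZ a d : ext_der h (a *: d) = toloc h a *: ext_der h d.
Proof.
apply: der_ext => u; apply: val_inj.
suff : frac_der (a *: d) (val u) = a%:F * frac_der d (val u) by [].
rewrite /frac_der mulrA -tofracM; congr (_%:F / _).
by rewrite !derZE mulrBr !mulrA [_ * a]mulrC.
Qed.

Lemma ext_derN d : ext_der h (- d) = - ext_der h d.
Proof. by rewrite -scaleN1r ext_derZ rmorphN1 scaleN1r. Qed.

Lemma ext_der_inj : injective (ext_der h).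
Proof.
move=> d e de; apply: der_ext => f; apply: (@toloc_inj h).
by rewrite -!ext_derE de.
Qed.

End ExtensionLinear.

(* For B = A or A[h^-1], the module of differentials of B is free on dx and dy;
   a form is the row of its coordinates on this basis. *)
Definition kform (B : nzRingType) := 'rV[B]_2.
Definition dX (B : nzRingType) : kform B := delta_mx 0 0.
Definition dY (B : nzRingType) : kform B := delta_mx 0 1.
Definition dform (f : A) : kform A := \row_i mderiv i f.

Section Hamiltonian.
Variable h : A.

Definition poisson (f g : A) : A :=
  h * (mderiv 0 f * mderiv 1 g - mderiv 1 f * mderiv 0 g).

Lemma poisson_linear f : linear (poisson f).
Proof.
move=> c u v; rewrite /poisson !linearP /= -!mul_mpolyC.
move: (mderiv _ f) (mderiv _ f) (mderiv _ u) (mderiv _ u) (mderiv _ v)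
  (mderiv _ v) c%:MP => f0 f1 u0 u1 v0 v1 a.
ring.
Qed.
HB.instance Definition _ f :=
  GRing.isLinear.Build K A A *:%R (poisson f) (poisson_linear f).

Lemma poisson_leibniz f : leibniz (poisson f).
Proof. by move=> u v; rewrite /poisson !mderivM; ring. Qed.

Definition poisson_der f : der A := Der (poisson_leibniz f).

Definition ham (w : kform A) : der A :=
  w 0 0 *: poisson_der polX + w 0 1 *: poisson_der polY.

Definition ham_loc (w : kform (loc h)) : der (loc h) :=
  w 0 0 *: ext_der h (ham (dX A)) + w 0 1 *: ext_der h (ham (dY A)).

Lemma mderiv_polX i : mderiv i polX = (i == 0)%:R.
Proof.
rewrite /polX mderivX mnm1E eq_sym; case: (i =P 0) => [->|_]; last by rewrite scale0r.
rewrite scale1r -[RHS]mpolyX0; congr 'X_[_]; apply/mnmP => j.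
by rewrite mnmBE mnm0E subnn.
Qed.

Lemma mderiv_polY i : mderiv i polY = (i == 1)%:R.
Proof.
rewrite /polY mderivX mnm1E eq_sym; case: (i =P 1) => [->|_]; last by rewrite scale0r.
rewrite scale1r -[RHS]mpolyX0; congr 'X_[_]; apply/mnmP => j.
by rewrite mnmBE mnm0E subnn.
Qed.

Lemma poissonXY : poisson polX polY = h.
Proof.
by rewrite /poisson !mderiv_polX !mderiv_polY /= mulr1 mulr0 subr0 mulr1.
Qed.

Lemma ham_dform f : ham (dform f) = poisson_der f.
Proof.
apply: der_ext => g; rewrite derDE !derZE /= /poisson !mxE.
rewrite !mderiv_polX !mderiv_polY /=.
move: (mderiv _ f) (mderiv _ f) (mderiv _ g) (mderiv _ g) => a b c e.
ring.
Qed.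

Lemma ham_dX : ham (dX A) = h *: partialY.
Proof.
apply: der_ext => g; rewrite derDE !derZE /= /poisson !mxE /=.
rewrite !mderiv_polX /=; move: (mderiv _ g) (mderiv _ g) => c e.
ring.
Qed.

Lemma ham_dY : ham (dY A) = - (h *: partialX).
Proof.
apply: der_ext => g; rewrite derDE derNE !derZE /= /poisson !mxE /=.
rewrite !mderiv_polY /=; move: (mderiv _ g) (mderiv _ g) => c e.
ring.
Qed.

Lemma ham_loc_ext (u : loc h) (w : kform A) :
  ham_loc (u *: map_mx (toloc h) w) = u *: ext_der h (ham w).
Proof.
have -> : ham w = w 0 0 *: ham (dX A) + w 0 1 *: ham (dY A).
  rewrite /ham !mxE /=; apply: der_ext => f; rewrite !(derDE, derZE) /=.
  by rewrite !mul1r !mul0r addr0 add0r.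
by rewrite ext_derD !ext_derZ /ham_loc !mxE scalerDr !scalerA.
Qed.

Definition der_log (d : der A) : Prop := exists g, d h = h * g.

Definition pairing (w : kform (loc h)) (d : der (loc h)) : loc h :=
  w 0 0 * d (toloc h polX) + w 0 1 * d (toloc h polY).

(* The dual of der_log, realized inside the forms over A[h^-1]. *)
Definition form_log (w : kform (loc h)) : Prop :=
  forall d, der_log d -> exists f, pairing w (ext_der h d) = toloc h f.

Lemma ham_loc_log w : form_log w ->
  exists d : {d | der_log d}, ext_der h (sval d) = ham_loc w.
Proof.
move=> wlog; have pE (d : der A) : pairing w (ext_der h d) =
    w 0 0 * toloc h (d polX) + w 0 1 * toloc h (d polY).
  by rewrite /pairing !ext_derE.
have [|a] := wlog (h *: partialX); first by exists (mderiv 0 h).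
have [|b] := wlog (h *: partialY); first by exists (mderiv 1 h).
have [|c] := wlog (mderiv 1 h *: partialX - mderiv 0 h *: partialY).
  exists 0; rewrite derDE derNE !derZE /= mulr0.
  by rewrite [X in _ - X]mulrC subrr.
rewrite !pE !(derDE, derNE, derZE) /= !mderiv_polX !mderiv_polY /=.
rewrite !(mulr1, mulr0, subr0, sub0r, rmorph0, addr0, add0r) => ec eb ea.
have dlog : der_log (a *: partialY - b *: partialX).
  exists c; apply: (@toloc_inj h); rewrite derDE derNE !derZE /=.
  rewrite rmorphB !rmorphM /= -ea -eb -ec rmorphN /=.
  move: (toloc h h) (toloc h (mderiv 0 h)) (toloc h (mderiv 1 h)) => hh hx hy.
  move: (w 0 0) (w 0 1) => w0 w1; ring.
exists (exist _ _ dlog) => /=.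
rewrite /ham_loc ham_dX ham_dY ext_derD !ext_derN !ext_derZ -ea -eb.
by rewrite scalerN !scalerA.
Qed.

(* The restriction of ham_loc to the logarithmic forms; der A is seen inside
   der (loc h) through ext_der, which is injective. *)
Definition pi_log (w : {w | form_log w}) : {d | der_log d} :=
  sval (cid (ham_loc_log (svalP w))).

Lemma pi_logE w : ext_der h (sval (pi_log w)) = ham_loc (sval w).
Proof. by rewrite /pi_log; case: cid. Qed.

End Hamiltonian.
End LogarithmicHamiltonian.

(* Main.v *)
(* Since t * h_t(t) is squarefree, every logarithmic d satisfies d(xy) = h e,
   whence d x = x f and d y = y g. So omega1 and omega2 pair with d to e / 2 and
   (g - f) / 2, which makes both forms logarithmic; the formula then follows
   from H(dx) = h d/dy and H(dy) = - h d/dx. *)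

Require Import Defs.
From HB Require Import structures.
From mathcomp Require Import all_boot all_order all_algebra.
From mathcomp Require Import mpoly.
From mathcomp Require Import complex.
From mathcomp Require Import boolp reals.
From mathcomp Require Import ring.

Import GRing.Theory.
Local Open Scope ring_scope.

(** Chain rule, by induction on the Horner form; constants contribute nothing because [d] is
    [K]-linear and kills 1. *)
Lemma der_horner_alg (K : fieldType) (B : comAlgType K) (d : der B) (t : B)
    (p : {poly K}) : d (horner_alg t p) = horner_alg t p^`() * d t.
Proof.
elim/poly_ind: p => [|p c IHp]; first by rewrite deriv0 !rmorph0 raddf0 mul0r.
rewrite derivD derivM derivX derivC mulr1 addr0 !rmorphD !rmorphM /= raddfD /=.
rewrite horner_algX horner_algC der_leibniz IHp linearZ /= der1 scaler0.
ring.
Qed.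

Lemma coprimep_XM_deriv (K : fieldType) (p : {poly K}) :
  p.[0] != 0 -> coprimep p p^`() -> coprimep ('X * p) ('X * p)^`().
Proof.
move=> p0 cp; rewrite derivM derivX mul1r coprimepMl; apply/andP; split.
  by rewrite addrC mulrC coprimep_addl_mul coprimep_sym coprimepX.
rewrite -[X in coprimep _ (X + _)]mul1r coprimep_addl_mul coprimepMr cp andbT.
by rewrite coprimepX.
Qed.

(** The substitution [s] sets ['X_i] to 0. Congruence modulo ['X_i] with the image under [s] holds
    for each variable and survives products and linear combinations. *)
Lemma mpoly_comp0_divX (n : nat) (K : comNzRingType) (i : 'I_n)
    (p : {mpoly K[n]}) :
  let s := [tuple if k == i then 0 else 'X_k | k < n] in
  exists q, p = p \mPo s + 'X_i * q.
Proof.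
move=> s.
pose P (p : {mpoly K[n]}) := exists q, p = p \mPo s + 'X_i * q.
have PM p1 p2 : P p1 -> P p2 -> P (p1 * p2).
  (* Expand [p1] in [p1 * p2] first, then [p2] only in the term where [p1] has become
     [p1 \mPo s]. *)
  move=> [q1 e1] [q2 e2]; exists (q1 * p2 + (p1 \mPo s) * q2).
  rewrite rmorphM {1}e1 {1}e2 {3}e2; ring.
have PXk k : P 'X_k.
  rewrite /P comp_mpolyXU -tnth_nth tnth_mktuple; case: eqP => [->|_].
    by exists 1; rewrite add0r mulr1.
  by exists 0; rewrite mulr0 addr0.
have P1 : P 1 by exists 0; rewrite comp_mpoly1 mulr0 addr0.
elim/mpolyind: p => [|c m p _ _ IHp]; first by exists 0; rewrite comp_mpoly0 mulr0 addr0.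
have [q0 e0] : P 'X_[m].
  rewrite mpolyXE_id; apply: (big_ind P) => // k _.
  by elim: (m k) => [|l IHl]; rewrite ?expr0 // exprS; apply: PM.
have [q eq] := IHp; exists (c *: q0 + q).
rewrite comp_mpolyD comp_mpolyZ {1}e0 {1}eq scalerDr mulrDr -scalerAr.
by rewrite addrACA.
Qed.

Lemma mpolyXU_neq0 (n : nat) (K : nzRingType) (i : 'I_n) :
  'X_i != 0 :> {mpoly K[n]}.
Proof.
apply/eqP => /(congr1 (mcoeff U_(i)))/eqP.
by rewrite mcoeffX eqxx mcoeff0 oner_eq0.
Qed.

(** Setting ['X_i] to 0 kills the right side but leaves ['X_j] intact, so in a domain [p] vanishes
    at ['X_i = 0]. *)
Lemma mpolyXU_gauss (n : nat) (K : idomainType) (i j : 'I_n)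
    (p q : {mpoly K[n]}) :
  i != j -> 'X_j * p = 'X_i * q -> exists r, p = 'X_i * r.
Proof.
move=> ij e; have [r pE] := mpoly_comp0_divX _ _ i p.
set s := [tuple _ | _ < n] in pE; exists r.
have := congr1 (fun u => u \mPo s) e.
rewrite /= !rmorphM /= !comp_mpolyXU -!tnth_nth !tnth_mktuple eqxx.
rewrite eq_sym (negPf ij) mul0r.
move/eqP; rewrite mulf_eq0 => /orP[|/eqP p0]; last by rewrite {1}pE p0 add0r.
by rewrite (negPf (mpolyXU_neq0 _ _ _)).
Qed.

(* Bezout in K[t] for t * p(t) and its derivative, evaluated at t = xy, puts
   d(xy) in the ideal of h; hence x divides y * d(x) and y divides x * d(y). *)
Lemma der_log_monomials (K : fieldType) (p : {poly K}) (d : der {mpoly K[2]}) :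
  p.[0] != 0 -> coprimep p p^`() ->
  let h := polX K * polY K * horner_alg (polX K * polY K) p in
  der_log h d ->
  exists f g e, [/\ d (polX K) = polX K * f, d (polY K) = polY K * g &
                   d (polX K * polY K) = h * e].
Proof.
set x := polX K; set y := polY K => p0 cp h [k dh].
have /Bezout_eq1_coprimepP[[u v] /= buv] := coprimep_XM_deriv _ _ p0 cp.
have [e dxy] : exists e, d (x * y) = h * e.
  (* Multiply the Bezout identity at [x * y] by [d (x * y)]: the [u] term contains [h], and by the
     chain rule the [v] term contains [d h = h * k]. *)
  exists (horner_alg (x * y) u * d (x * y) + horner_alg (x * y) v * k).
  have := congr1 (horner_alg (x * y)) buv.
  rewrite rmorphD !rmorphM rmorph1 /= horner_algX -/h => b1.
  rewrite -[LHS]mul1r -b1 mulrDl -[_ * d _ in X in _ + X]mulrA -der_horner_alg.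
  by rewrite rmorphM /= horner_algX -/h dh; ring.
have dxyE := der_leibniz d x y.
have [f dx] : exists f, d x = x * f.
  suff: y * d x = x * (y * horner_alg (x * y) p * e - d y) by exact: mpolyXU_gauss.
  apply: (addrI (x * d y)); rewrite -dxyE dxy /h.
  move: (horner_alg _ _) => q; ring.
have [g dy] : exists g, d y = y * g.
  suff: x * d y = y * (x * horner_alg (x * y) p * e - d x) by exact: mpolyXU_gauss.
  apply: (addIr (y * d x)); rewrite -dxyE dxy /h.
  move: (horner_alg _ _) => q; ring.
by exists f, g, e.
Qed.

(** [h] has inverse 1/h in the localization, and a divisor of a unit is a unit. *)
Lemma toloc_unit_dvd (K : fieldType) (h f g : {mpoly K[2]}) :
  h != 0 -> h = f * g -> toloc h f \is a GRing.unit.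
Proof.
move=> h0 hE; suff : toloc h h \is a GRing.unit.
  by rewrite [X in toloc h X]hE rmorphM unitrM => /andP[].
have hF : FracField.tofrac h != 0 by rewrite tofrac_eq0.
apply/andP; split=> //.
by apply/is_locP; exists 1, 1%N; rewrite tofrac1 mul1r expr1.
Qed.

(** Identifies the factor 1/2 of the forms, an inverse taken in [loc h], with the image of a
    constant polynomial. *)
Lemma toloc_natr_inv (K : fieldType) (h : {mpoly K[2]}) (m : nat) :
  m%:R != 0 :> K ->
  m%:R \is a @GRing.unit (loc h) /\ m%:R^-1 = toloc h (m%:R^-1)%:MP.
Proof.
move=> m0; have mV : m%:R * toloc h (m%:R^-1)%:MP = 1.
  by rewrite -(rmorph_nat (toloc h)) -rmorphM -mpolyC_nat -mpolyCM mulfV // !rmorph1.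
have mU : m%:R \is a @GRing.unit (loc h) by apply/unitrPr; exists (toloc h (m%:R^-1)%:MP).
by split=> //; apply: (mulrI mU); rewrite mulrV.
Qed.

Lemma meval_horner_alg (n : nat) (K : comNzRingType) (v : 'I_n -> K)
    (t : {mpoly K[n]}) (p : {poly K}) : (horner_alg t p).@[v] = p.[t.@[v]].
Proof.
elim/poly_ind: p => [|p c IHp]; first by rewrite rmorph0 raddf0 horner0.
rewrite rmorphD rmorphM /= horner_algX horner_algC mevalD mevalM IHp.
by rewrite hornerD hornerMX hornerC mevalZ meval1 mulr1.
Qed.

(** The last factor takes the value [p.[0]] at the origin. *)
Lemma polXY_horner_neq0 (K : fieldType) (p : {poly K}) :
  p.[0] != 0 -> polX K * polY K * horner_alg (polX K * polY K) p != 0.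
Proof.
move=> p0; rewrite !mulf_neq0 ?mpolyXU_neq0 //.
apply: contraNneq p0 => /(congr1 (meval (fun=> 0))).
by rewrite meval_horner_alg mevalM !mevalXU mulr0 meval0 => ->.
Qed.

(** Isolates what depends on [h] only through its factorization [x * y * q] and the shape of its
    logarithmic derivations. *)
Lemma pi_log_omega (K : fieldType) (h q a b : {mpoly K[2]}) :
  let x := polX K in let y := polY K in
  let omega1 : kform (loc h) :=
    (toloc h y / (2 * toloc h h)) *: dX (loc h)
    + (toloc h x / (2 * toloc h h)) *: dY (loc h) in
  let omega2 : kform (loc h) :=
    (2 * toloc h y)^-1 *: dY (loc h) - (2 * toloc h x)^-1 *: dX (loc h) in
  2%:R != 0 :> K -> h != 0 -> h = x * y * q ->
  (forall d, der_log h d ->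
     exists f g e, [/\ d x = x * f, d y = y * g & d (x * y) = h * e]) ->
  exists omega_log : form_log (toloc h a *: omega1 + toloc h b *: omega2),
    sval (pi_log (exist _ _ omega_log)) =
    (2^-1)%:MP *: (a *: (y *: partialY K - x *: partialX K)
                   - b *: (q *: (x *: partialX K + y *: partialY K))).
Proof.
move=> x y omega1 omega2 two0 h0 hE hder; set l := toloc h.
have lM : {morph l : u v / u * v} by exact: (rmorphM (toloc h)).
have lD : {morph l : u v / u + v} by exact: (rmorphD (toloc h)).
have lB : {morph l : u v / u - v} by exact: (rmorphB (toloc h)).
have lhE : l h = l x * l y * l q by rewrite -!lM; congr l.
have hU : l h \is a GRing.unit.
  by apply: (@toloc_unit_dvd _ _ _ 1); rewrite ?mulr1.
have xU : l x \is a GRing.unit.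
  by apply: (@toloc_unit_dvd _ _ _ (y * q)); rewrite ?mulrA.
have yU : l y \is a GRing.unit.
  by apply: (@toloc_unit_dvd _ _ _ (x * q)); rewrite // mulrCA mulrA.
have [twoU twoV] := @toloc_natr_inv K h 2 two0.
set w := l a *: omega1 + l b *: omega2; set half := toloc h (2^-1)%:MP in twoV.
have w0 : w 0 0 = half * (l a * l y / l h - l b / l x).
  rewrite !mxE /= !(invrM twoU) // !twoV -/l; ring.
have w1 : w 0 1 = half * (l a * l x / l h + l b / l y).
  rewrite !mxE /= !(invrM twoU) // !twoV -/l; ring.
have w_log : form_log w.
  move=> d /hder [f [g [e [dx dy dxy]]]].
  (* Here [omega1] is d(xy)/(2h), and [omega2] is half the logarithmic differential of y/x. *)
  exists ((2^-1)%:MP * (a * e + b * (g - f))).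
  rewrite /pairing w0 w1 !ext_derE -/x -/y -/l.
  have {}dxy : l x * l (d y) + l y * l (d x) = l h * l e.
    by rewrite -!lM -lD -der_leibniz dxy.
  rewrite -/l lM -/half lD !lM lB.
  transitivity (half * (l a * ((l h)^-1 * (l x * l (d y) + l y * l (d x)))
      + l b * ((l y)^-1 * l (d y) - (l x)^-1 * l (d x)))).
    ring.
  by rewrite dxy dx dy !lM !mulKr.
(* Equality of derivations of A may be tested after extension to A[1/h], where [pi_log] is given by
   [ham_loc]. *)
exists w_log; apply: (@ext_der_inj _ h); rewrite pi_logE /= -/w /ham_loc w0 w1.
rewrite ham_dX ham_dY.
(* The factor [h] brought by H(dx) clears the denominators, with h/x = yq; this is the coefficient
   of [partialY]. *)
have c0 : half * (l a * l y / l h - l b / l x) * l h =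
    l ((2^-1)%:MP * (a * y - b * (y * q))).
  rewrite lM lB !lM -/half.
  transitivity (half * (l a * l y * ((l h)^-1 * l h) - l b * ((l x)^-1 * l h))).
    ring.
  by rewrite mulVr // mulr1 lhE -[l x * l y * _]mulrA mulKr.
(* Likewise for H(dy), with h/y = xq; this is the coefficient of [- partialX]. *)
have c1 : half * (l a * l x / l h + l b / l y) * l h =
    l ((2^-1)%:MP * (a * x + b * (x * q))).
  rewrite lM lD !lM -/half.
  transitivity (half * (l a * l x * ((l h)^-1 * l h) + l b * ((l y)^-1 * l h))).
    ring.
  by rewrite mulVr // mulr1 lhE [l x * l y]mulrC -[l y * l x * _]mulrA mulKr.
rewrite -scalerN !ext_derZ !scalerA c0 c1 -!ext_derZ -ext_derD; congr ext_der.
apply: der_ext => u; rewrite !(derDE, derNE, derZE).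
move: (partialX K u) (partialY K u) => ux uy; ring.
Qed.

Theorem corollary4p5 (R : realType) (n : nat) (alpha : nat -> R[i])
    (n_gt0 : (0 < n)%N) (alpha_neq0 : alpha 1%N * alpha n != 0) :
  let ht : {poly R[i]} := \sum_(1 <= i < n.+1) alpha i *: 'X^(i.-1) in
  coprimep ht ht^`() ->
  let x : {mpoly R[i][2]} := polX R[i] in
  let y : {mpoly R[i][2]} := polY R[i] in
  let hxy : {mpoly R[i][2]} := horner_alg (x * y) ht in
  let h : {mpoly R[i][2]} := x * y * hxy in
  let delta1 : der {mpoly R[i][2]} :=
    hxy *: (x *: partialX R[i] + y *: partialY R[i]) in
  let delta2 : der {mpoly R[i][2]} :=
    y *: partialY R[i] - x *: partialX R[i] in
  let omega1 : kform (loc h) :=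
    (toloc h y / (2 * toloc h h)) *: dX (loc h)
    + (toloc h x / (2 * toloc h h)) *: dY (loc h) in
  let omega2 : kform (loc h) :=
    (2 * toloc h y)^-1 *: dY (loc h) - (2 * toloc h x)^-1 *: dX (loc h) in
  forall a b : {mpoly R[i][2]},
  exists omega_log : form_log (toloc h a *: omega1 + toloc h b *: omega2),
    sval (pi_log (exist _ _ omega_log))
    = (2^-1)%:MP *: (a *: delta2 - b *: delta1).
Proof.
move=> ht cop x y hxy h delta1 delta2 omega1 omega2 a b.
(* The exponent is [i.-1], so at 0 only the term [i = 1] survives; [n_gt0] puts it in the range. *)
have ht0 : ht.[0] = alpha 1%N.
  rewrite horner_sum big_ltn // big_nat big1 ?addr0 => [|i /andP[i1 _]].
    by rewrite hornerZ expr0 hornerC mulr1.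
  by rewrite hornerZ hornerXn expr0n -subn1 subn_eq0 leqNgt i1 mulr0.
have ht00 : ht.[0] != 0.
  by rewrite ht0; apply: contraNneq alpha_neq0 => ->; rewrite mul0r.
apply: pi_log_omega => //.
- by rewrite Num.Theory.pnatr_eq0.
- exact: (@polXY_horner_neq0 R[i] ht).
- by move=> d; apply: der_log_monomials.
Qed.
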